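(* (a) Let $(E,\star,\rho,(\cdot,\cdot)_-,P)$ be a para-complex pre-symplectic algebroid. Then $(E,[\cdot,\cdot]_E,\rho,\omega=(\cdot,\cdot)_-,P)$, where $[e_1,e_2]_E=e_1\star e_2-e_2\star e_1$, is a para-Kähler Lie algebroid. (b) Conversely, if $(E,[\cdot,\cdot]_E,\rho,\omega,P)$ is a para-Kähler Lie algebroid, then $(E,\star,\rho,(\cdot,\cdot)_-=\omega,P)$ is a para-complex pre-symplectic algebroid, where $\star$ is defined by $$\omega(e_1\star e_2,e_3)=\rho(e_1)\omega(e_2,e_3)+\tfrac12\rho(e_3)\omega(e_1,e_2)-\omega(e_2,[e_1,e_3]_E),\qquad\forall e_1,e_2,e_3\in\Gamma(E).$$
   Context: All vector bundles are real, of finite rank, over a fixed smooth manifold $M$; bundle maps cover the identity of $M$. A Lie algebroid $(E,[\cdot,\cdot]_E,\rho)$ is a vector bundle $E\to M$ with a Lie algebra structure on $\Gamma(E)$ and a bundle map $\rho:E\to TM$ with $[e_1,fe_2]_E=f[e_1,e_2]_E+\rho(e_1)(f)e_2$. A symplectic Lie algebroid $(E,[\cdot,\cdot]_E,\rho,\omega)$ is a Lie algebroid together with a nondegenerate $\omega\in\Gamma(\wedge^2E^* )$ that is closed: $\rho(x)\omega(y,z)-\rho(y)\omega(x,z)+\rho(z)\omega(x,y)-\omega([x,y]_E,z)+\omega([x,z]_E,y)-\omega([y,z]_E,x)=0$ for all $x,y,z\in\Gamma(E)$. A para-complex structure on a Lie algebroid $(E,[\cdot,\cdot]_E,\rho)$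 is a bundle map $P:E\to E$ with $P^2=\mathrm{id}$ and $P[e_1,e_2]_E=[P(e_1),e_2]_E+[e_1,P(e_2)]_E-P[P(e_1),P(e_2)]_E$ for all $e_1,e_2\in\Gamma(E)$. A para-Kähler Lie algebroid $(E,[\cdot,\cdot]_E,\rho,\omega,P)$ is a symplectic Lie algebroid with a para-complex structure $P$ such that $\omega(P(e_1),e_2)+\omega(e_1,P(e_2))=0$ for all $e_1,e_2\in\Gamma(E)$. A pre-symplectic algebroid $(E,\star,\rho,(\cdot,\cdot)_-)$ is a vector bundle $E\to M$ equipped with a nondegenerate skew-symmetric ($C^\infty(M)$-)bilinear form $(\cdot,\cdot)_-$, an ($\mathbb R$-bilinear) multiplication $\star:\Gamma(E)\times\Gamma(E)\to\Gamma(E)$ and a bundle map $\rho:E\to TM$ such that, with the commutator bracket $[e_1,e_2]_\star=e_1\star e_2-e_2\star e_1$, for all $e_1,e_2,e_3\in\Gamma(E)$: (i) $(e_1,e_2,e_3)-(e_2,e_1,e_3)=\frac16 D\,T(e_1,e_2,e_3)$; (ii) $\rho(e_1)(e_2,e_3)_-=(e_1\star e_2-\frac12D(e_1,e_2)_-,\,e_3)_-+(e_2,[e_1,e_3]_\star)_-$. Here $(e_1,e_2,e_3)=e_1\star(e_2\star e_3)-(e_1\star e_2)\star e_3$; $T(e_1,e_2,e_3)=(e_1\star e_2,e_3)_-+(e_1,e_2\star e_3)_--(e_2\star e_1,e_3)_--(e_2,e_1\star e_3)_-\in C^\infty(M)$; and $D:C^\infty(M)\to\Gamma(E)$ is defined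 by $(Df,e)_-=\rho(e)(f)$. A para-complex pre-symplectic algebroid $(E,\star,\rho,(\cdot,\cdot)_-,P)$ is a pre-symplectic algebroid with a bundle map $P:E\to E$ such that $P^2=\mathrm{id}$, $(P(x),P(y))_-=-(x,y)_-$, and $P(e_1\star e_2)=P(e_1)\star e_2+e_1\star P(e_2)-P(P(e_1)\star P(e_2))$ for all sections. *)

(* Defs.v *)
From HB Require Import structures.
From mathcomp Require Import all_boot all_order all_algebra.
From mathcomp Require Import all_classical all_reals all_analysis.
Set Implicit Arguments.
Unset Strict Implicit.
Unset Printing Implicit Defensive.
Import Order.TTheory GRing.Theory Num.Theory.
Import numFieldNormedType.Exports.
Local Open Scope classical_set_scope.
Local Open Scope ring_scope.

Lemma near_eq_differentiable (R : realType) (V W : normedModType R)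
    (f g : V -> W) (x : V) :
  (\forall y \near x, f y = g y) -> differentiable f x -> differentiable g x.
Proof.
move=> fg df.
have gE : g \o shift x = cst (g x) + 'd f x +o_ 0 id.
  apply/eqaddoP => e e0; have /diff_locallyP[_ /eqaddoP/(_ _ e0)] := df.
  move: (fg); rewrite (near_shift 0 x) => fg0.
  apply: filterS2 fg0 => y /= fgy.
  rewrite -(nbhs_singleton fg).
  move: fgy; rewrite subr0 => fgy.
  rewrite -[(f \o _ - _) y]/(f (y + x) - _) -[(g \o _ - _) y]/(g (y + x) - _).
  by rewrite -fgy.
apply/diff_locallyP.
have cd : continuous ('d f x) by exact: diff_continuous.
by rewrite (diff_unique cd gE).
Qed.

Section Ck.
Context {R : realType} {n : nat}.
Implicit Types (U V : set 'rV[R]_n) (f g : 'rV[R]_n -> R).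

(* [Ck k U f]: f is of class C^k on U. It is only meaningful for U open, since
   continuity and derivatives are taken in R^n and not within U. *)
Fixpoint Ck (k : nat) U f : Prop :=
  if k is k'.+1 then
    (forall x, U x -> differentiable f x) /\ (forall v, Ck k' U ('D_v f))
  else forall x, U x -> {for x, continuous f}.

Definition Cinfty U f : Prop := forall k, Ck k U f.

Lemma CkS k U f : Ck k.+1 U f -> Ck k U f.
Proof.
elim: k f => [|k IH] f [df Df]; first by move=> x /df /differentiable_continuous.
by split=> // v; exact: IH.
Qed.

Lemma Ck_eq k U f g : open U -> (forall x, U x -> f x = g x) ->
  Ck k U f -> Ck k U g.
Proof.
move=> oU; have near_eq f' g' : (forall x, U x -> f' x = g' x) ->
    forall x, U x -> \forall y \near x, (f' y : R) = g' y.
  move=> fg x Ux; near=> y; apply: fg; near: y; exact: open_nbhs_nbhs.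
elim: k f g => [|k IH] f g fg.
  move=> cf x Ux; have := cf x Ux; rewrite /prop_for /continuous_at -(fg x Ux).
  by apply: cvg_trans; apply: near_eq_cvg; [exact: nbhs_filter|exact: near_eq].
move=> [df Df]; split=> [x Ux|v].
  by apply: near_eq_differentiable (df _ Ux); exact: near_eq.
by apply: IH (Df v) => x Ux; apply: near_eq_derive; exact: near_eq.
Unshelve. all: by end_near. Qed.

Lemma Ck_bigcup k (I : Type) (U : I -> set 'rV[R]_n) V f :
  (forall x, V x -> exists i, U i x) -> (forall i, Ck k (U i) f) -> Ck k V f.
Proof.
move=> VU; elim: k f => [|k IH] f Uf.
  by move=> x /VU[i Uix]; exact: Uf Uix.
split=> [x /VU[i Uix]|v]; first by have [+ _] := Uf i; exact.
by apply: IH => i; have [_] := Uf i; exact.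
Qed.

Lemma Ck_cst k U (a : R) : Ck k U (cst a).
Proof.
elim: k a => [|k IH] a; first by move=> x _; exact: cst_continuous.
split=> [//|v]; have -> : 'D_v (cst a : _ -> R) = cst 0; last exact: IH.
by apply/funext => x; exact: derive_cst.
Qed.

Lemma CkD k U f g : open U -> Ck k U f -> Ck k U g -> Ck k U (f + g).
Proof.
move=> oU; elim: k f g => [|k IH] f g.
  by move=> cf cg x Ux; apply: continuousD; [exact: cf|exact: cg].
move=> [df Df] [dg Dg]; split=> [x Ux|v].
  by apply: differentiableD; [exact: df|exact: dg].
apply: Ck_eq (IH _ _ (Df v) (Dg v)) => // x Ux.
by rewrite deriveD//; apply: diff_derivable; [exact: df|exact: dg].
Qed.

Lemma CkM k U f g : open U -> Ck k U f -> Ck k U g -> Ck k U (f * g).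
Proof.
move=> oU; elim: k f g => [|k IH] f g.
  by move=> cf cg x Ux; apply: continuousM; [exact: cf|exact: cg].
move=> Cf Cg; have [df Df] := Cf; have [dg Dg] := Cg; split=> [x Ux|v].
  by apply: differentiableM; [exact: df|exact: dg].
have CD : Ck k U (f * 'D_v g + g * 'D_v f).
  by apply: CkD => //; apply: IH => //; solve [exact: CkS|exact: Df|exact: Dg].
apply: Ck_eq CD => // x Ux.
by rewrite deriveM//; apply: diff_derivable; [exact: df|exact: dg].
Qed.

End Ck.

Record chart (R : realType) (n : nat) (M : topologicalType) := Chart {
  chart_dom : set M;
  chart_cod : set 'rV[R]_n;
  chart_map :> M -> 'rV[R]_n;
  chart_inv : 'rV[R]_n -> M;
  chart_dom_open : open chart_dom;
  chart_cod_open : open chart_cod;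
  chart_map_cod : forall x, chart_dom x -> chart_cod (chart_map x);
  chart_inv_dom : forall y, chart_cod y -> chart_dom (chart_inv y);
  chart_mapK : forall x, chart_dom x -> chart_inv (chart_map x) = x;
  chart_invK : forall y, chart_cod y -> chart_map (chart_inv y) = y;
  chart_map_continuous : {in chart_dom, continuous chart_map};
  chart_inv_continuous : {in chart_cod, continuous chart_inv} }.

(* The atlas is not required to be maximal: an atlas and the maximal atlas
   containing it define the same smooth functions. *)
Record manifold (R : realType) (n : nat) := Manifold {
  mf_space :> topologicalType;
  mf_hausdorff : hausdorff_space mf_space;
  mf_second_countable : @second_countable mf_space;
  mf_idx : Type;
  mf_chart : mf_idx -> chart R n mf_space;
  mf_cover : forall x, exists i, chart_dom (mf_chart i) x;
  mf_smooth : forall (i j : mf_idx) (a : 'I_n),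
    Cinfty [set y | chart_cod (mf_chart i) y /\
                    chart_dom (mf_chart j) (chart_inv (mf_chart i) y)]
           (fun y => mf_chart j (chart_inv (mf_chart i) y) 0 a) }.

Section SmoothFunctions.
Context {R : realType} {n : nat} (M : manifold R n).
Implicit Types (O : set M).

(* smoothness of f on the open subset O of M *)
Definition smooth_on O (f : M -> R) : Prop := forall i : mf_idx M,
  Cinfty [set y | chart_cod (mf_chart i) y /\ O (chart_inv (mf_chart i) y)]
         (f \o chart_inv (mf_chart i)).

Lemma open_chart_preimage O (i : mf_idx M) : open O ->
  open [set y | chart_cod (mf_chart i) y /\ O (chart_inv (mf_chart i) y)].
Proof.
move=> oO; rewrite openE => y [cy Oy]; apply: filterI.
  by apply: open_nbhs_nbhs; split=> //; exact: chart_cod_open.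
apply: (@chart_inv_continuous _ _ _ (mf_chart i) y); first exact/mem_set.
exact: open_nbhs_nbhs.
Qed.

Lemma smooth_on_eq O (f g : M -> R) : open O -> (forall x, O x -> f x = g x) ->
  smooth_on O f -> smooth_on O g.
Proof.
move=> oO fg sf i k; apply: Ck_eq (sf i k); first exact: open_chart_preimage.
by move=> y [_ Oy]; exact: fg.
Qed.

Lemma smooth_on_bigcup (I : Type) (U : I -> set M) O (f : M -> R) :
  (forall x, O x -> exists i, U i x) -> (forall i, smooth_on (U i) f) ->
  smooth_on O f.
Proof.
move=> OU sf i k; apply: (Ck_bigcup (U := fun j =>
  [set y | chart_cod (mf_chart i) y /\ U j (chart_inv (mf_chart i) y)])).
  by move=> y [cy /OU[j Uj]]; exists j.
by move=> j; exact: sf.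
Qed.

Lemma smooth_on_sub O O' (f : M -> R) : O' `<=` O -> smooth_on O f -> smooth_on O' f.
Proof.
move=> OO' sf; apply: (smooth_on_bigcup (U := fun _ : unit => O)) => // x /OO' ?.
by exists tt.
Qed.

Lemma smooth_on_cst O (a : R) : smooth_on O (cst a).
Proof. by move=> i k; exact: Ck_cst. Qed.

Lemma smooth_onD O (f g : M -> R) : open O -> smooth_on O f -> smooth_on O g ->
  smooth_on O (f + g).
Proof.
move=> oO sf sg i k; have oP := open_chart_preimage (i := i) oO.
rewrite -[(f + g) \o _]/((f \o _) + (g \o _)).
by apply: CkD oP _ _; [exact: sf|exact: sg].
Qed.

Lemma smooth_onM O (f g : M -> R) : open O -> smooth_on O f -> smooth_on O g ->
  smooth_on O (f * g).
Proof.
move=> oO sf sg i k; have oP := open_chart_preimage (i := i) oO.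
rewrite -[(f * g) \o _]/((f \o _) * (g \o _)).
by apply: CkM oP _ _; [exact: sf|exact: sg].
Qed.

Lemma smooth_onZ O (a : R) (f : M -> R) : open O -> smooth_on O f ->
  smooth_on O (fun x => a * f x).
Proof. by move=> oO; apply: smooth_onM => //; exact: smooth_on_cst. Qed.

Lemma smooth_on_sum O m (F : 'I_m -> M -> R) : open O ->
  (forall a, smooth_on O (F a)) -> smooth_on O (fun x => \sum_a F a x).
Proof.
move=> oO sF; have -> : (fun x => \sum_a F a x) = \sum_a F a.
  by apply/funext => x; rewrite fct_sumE.
by elim/big_ind: _ => [|f g|a _] //; [exact: smooth_on_cst|exact: smooth_onD].
Qed.

(* C^oo(M), with its commutative ring and real vector space structures *)
Record smooth_fun := SmoothFun {
  smooth_fun_val :> M -> R;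
  smooth_fun_subproof : `[< smooth_on setT smooth_fun_val >] }.

Lemma smooth_funP (f : smooth_fun) : smooth_on setT f.
Proof. exact/asboolP/smooth_fun_subproof. Qed.

Definition is_smooth : pred (M -> R) := fun f => `[< smooth_on setT f >].

HB.instance Definition _ := [isSub for smooth_fun_val].
HB.instance Definition _ := [Choice of smooth_fun by <:].

Lemma is_smooth_subring : subring_closed is_smooth.
Proof.
split=> [|f g|f g]; rewrite !unfold_in.
- by apply/asboolP; exact: smooth_on_cst.
- move=> /asboolP sf /asboolP sg; apply/asboolP.
  apply: smooth_onD => //; first exact: openT.
  rewrite -mulN1r; apply: smooth_onM; [exact: openT| |exact: sg].
  exact: (smooth_on_cst _ (-1)).
- by move=> /asboolP sf /asboolP sg; apply/asboolP/smooth_onM; first exact: openT.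
Qed.

HB.instance Definition _ :=
  GRing.SubChoice_isSubComPzRing.Build (M -> R) is_smooth smooth_fun
    is_smooth_subring.

Lemma smooth_funE (f g : smooth_fun) : (forall x, f x = g x) -> f = g.
Proof. by move=> fg; apply/val_inj/funext. Qed.

Lemma smooth_fun_scale_subproof (a : R) (f : smooth_fun) :
  `[< smooth_on setT (fun x => a * f x) >].
Proof.
by apply/asboolP/smooth_onZ; [exact: openT|exact: smooth_funP].
Qed.

Definition smooth_fun_scale a f := SmoothFun (smooth_fun_scale_subproof a f).

Lemma smooth_fun_scaleA a b f :
  smooth_fun_scale a (smooth_fun_scale b f) = smooth_fun_scale (a * b) f.
Proof. by apply: smooth_funE => x /=; rewrite mulrA. Qed.
Lemma smooth_fun_scale1 : left_id 1 smooth_fun_scale.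
Proof. by move=> f; apply: smooth_funE => x /=; rewrite mul1r. Qed.
Lemma smooth_fun_scaleDr : right_distributive smooth_fun_scale +%R.
Proof. by move=> a f g; apply: smooth_funE => x /=; exact: mulrDr. Qed.
Lemma smooth_fun_scaleDl f : {morph smooth_fun_scale^~ f : a b / a + b}.
Proof. by move=> a b; apply: smooth_funE => x /=; exact: mulrDl. Qed.

HB.instance Definition _ := GRing.Zmodule_isLmodule.Build R smooth_fun
  smooth_fun_scaleA smooth_fun_scale1 smooth_fun_scaleDr smooth_fun_scaleDl.
End SmoothFunctions.

Section Tangent.
Context {R : realType} {n : nat} (M : manifold R n) (x : M).

(* T_x M, as the space of derivations of C^oo(M) at x *)
Record tangent := Tangent {
  tangent_val :> smooth_fun M -> R;
  tangent_linear : scalar tangent_val;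
  tangent_leibniz : forall f g : smooth_fun M,
    tangent_val (f * g) = tangent_val f * g x + f x * tangent_val g }.

Lemma tangentE (u v : tangent) : (forall f, u f = v f) -> u = v.
Proof.
case: u v => [u lu Lu] [v lv Lv] /= /funext uv; case: _ / uv in lv Lv *.
by congr Tangent; exact: Prop_irrelevance.
Qed.

HB.instance Definition _ := gen_eqMixin tangent.
HB.instance Definition _ := gen_choiceMixin tangent.

Program Definition tangent0 := @Tangent (fun=> 0) _ _.
Next Obligation. by move=> a f g; rewrite mulr0 addr0. Qed.
Next Obligation. by move=> f g /=; rewrite mul0r mulr0 addr0. Qed.

Program Definition tangentD (u v : tangent) :=
  @Tangent (fun f => u f + v f) _ _.
Next Obligation.
by move=> u v a f g; rewrite !tangent_linear mulrDr addrACA.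
Qed.
Next Obligation.
by move=> u v f g /=; rewrite !tangent_leibniz mulrDl mulrDr addrACA.
Qed.

Program Definition tangentZ (b : R) (u : tangent) :=
  @Tangent (fun f => b * u f) _ _.
Next Obligation.
by move=> b u a f g; rewrite tangent_linear mulrDr mulrCA.
Qed.
Next Obligation.
by move=> b u f g /=; rewrite tangent_leibniz mulrDr mulrA [f x * (_ * _)]mulrCA.
Qed.

Definition tangentN := tangentZ (-1).

Lemma tangentDA : associative tangentD.
Proof. by move=> u v w; apply: tangentE => f /=; rewrite addrA. Qed.
Lemma tangentDC : commutative tangentD.
Proof. by move=> u v; apply: tangentE => f /=; rewrite addrC. Qed.
Lemma tangent0D : left_id tangent0 tangentD.
Proof. by move=> u; apply: tangentE => f /=; rewrite add0r. Qed.
Lemma tangentND : left_inverse tangent0 tangentN tangentD.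
Proof. by move=> u; apply: tangentE => f /=; rewrite mulN1r addNr. Qed.
HB.instance Definition _ :=
  GRing.isZmodule.Build tangent tangentDA tangentDC tangent0D tangentND.

Lemma tangentZA a b u : tangentZ a (tangentZ b u) = tangentZ (a * b) u.
Proof. by apply: tangentE => f /=; rewrite mulrA. Qed.
Lemma tangent1Z : left_id 1 tangentZ.
Proof. by move=> u; apply: tangentE => f /=; rewrite mul1r. Qed.
Lemma tangentZDr : right_distributive tangentZ +%R.
Proof. by move=> a u v; apply: tangentE => f /=; exact: mulrDr. Qed.
Lemma tangentZDl u : {morph tangentZ^~ u : a b / a + b}.
Proof. by move=> a b; apply: tangentE => f /=; exact: mulrDl. Qed.
HB.instance Definition _ := GRing.Zmodule_isLmodule.Build R tangent
  tangentZA tangent1Z tangentZDr tangentZDl.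
End Tangent.
Arguments tangent {R n} M x.

(* A smooth real vector bundle of rank r over M, given by its fibres and a
   family of local trivializations [vb_triv i x : E_x -> R^r], x in [vb_dom i],
   with smooth transition functions; the manifold structure of the total space
   is determined by these data. Outside [vb_dom i] the values of [vb_triv i] and
   [vb_inv i] are irrelevant. *)
Record vector_bundle (R : realType) (n : nat) (M : manifold R n) (r : nat) :=
  VectorBundle {
  fibre :> M -> lmodType R;
  vb_idx : Type;
  vb_dom : vb_idx -> set M;
  vb_triv : vb_idx -> forall x, {linear fibre x -> 'rV[R]_r};
  vb_inv : vb_idx -> forall x, 'rV[R]_r -> fibre x;
  vb_dom_open : forall i, open (vb_dom i);
  vb_cover : forall x, exists i, vb_dom i x;
  vb_trivK : forall i x, vb_dom i x -> cancel (vb_triv i x) (vb_inv i x);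
  vb_invK : forall i x, vb_dom i x -> cancel (vb_inv i x) (vb_triv i x);
  vb_smooth : forall i j (v : 'rV[R]_r) (a : 'I_r),
    smooth_on (vb_dom i `&` vb_dom j)
              (fun x => vb_triv j x (vb_inv i x v) 0 a) }.

Section Bundles.
Context {R : realType} {n r : nat} {M : manifold R n}.
Variable E : vector_bundle M r.

(* the local frame of E given by the trivialization i *)
Definition frame (i : vb_idx E) (a : 'I_r) (x : M) : E x :=
  vb_inv i x (delta_mx 0 a).

Lemma frame_decomp i x (v : E x) : vb_dom i x ->
  v = \sum_a vb_triv i x v 0 a *: frame i a x.
Proof.
move=> Ux; apply: (can_inj (vb_trivK Ux)); rewrite linear_sum /=.
rewrite [LHS]row_sum_delta; apply: eq_bigr => a _.
by rewrite linearZ /= vb_invK.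
Qed.

(* Gamma(E) *)
Record section := Section {
  section_val :> forall x, E x;
  section_smooth : forall i a,
    smooth_on (vb_dom i) (fun x => vb_triv i x (section_val x) 0 a) }.

(* a bundle map E -> E covering the identity *)
Record bundle_map := BundleMap {
  bundle_map_val :> forall x, {linear E x -> E x};
  bundle_map_smooth : forall i j a b,
    smooth_on (vb_dom i `&` vb_dom j)
              (fun x => vb_triv j x (bundle_map_val x (frame i a x)) 0 b) }.

(* a bundle map E -> TM covering the identity; a local vector field X is smooth
   iff X(f) is smooth for every f in C^oo(M) *)
Record anchor := Anchor {
  anchor_val :> forall x, {linear E x -> tangent M x};
  anchor_smooth : forall i a (f : smooth_fun M),
    smooth_on (vb_dom i) (fun x => anchor_val x (frame i a x) f) }.

(* a smooth section of wedge^2 E^* *)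
Record two_form := TwoForm {
  two_form_val :> forall x, {biscalar E x};
  two_form_skew : forall x (u v : E x),
    two_form_val x u v = - two_form_val x v u;
  two_form_smooth : forall i a b,
    smooth_on (vb_dom i)
              (fun x => two_form_val x (frame i a x) (frame i b x)) }.

Definition nondegenerate_form (om : two_form) : Prop :=
  forall x (u : E x), (forall v, om x u v = 0) -> u = 0.

Lemma sectionE (s t : section) : (forall x, s x = t x) -> s = t.
Proof.
case: s t => [s Ss] [t St] /= st.
have {}st : s = t by exact: functional_extensionality_dep.
by case: _ / st in St *; congr Section; exact: Prop_irrelevance.
Qed.

HB.instance Definition _ := gen_eqMixin section.
HB.instance Definition _ := gen_choiceMixin section.

Program Definition section0 : section := @Section (fun=> 0) _.
Next Obligation.
move=> i a; apply: (@smooth_on_eq _ _ _ _ (cst 0)).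
- exact: vb_dom_open.
- by move=> x _; rewrite linear0 mxE.
- exact: smooth_on_cst.
Qed.

Program Definition sectionD (s t : section) := @Section (fun x => s x + t x) _.
Next Obligation.
move=> s t i a; have oU := @vb_dom_open _ _ _ _ E i.
apply: smooth_on_eq oU _
  (smooth_onD oU (section_smooth s i a) (section_smooth t i a)).
by move=> x _; rewrite linearD mxE.
Qed.

(* the product of a smooth function and a section *)
Program Definition section_mul (f : smooth_fun M) (s : section) :=
  @Section (fun x => f x *: s x) _.
Next Obligation.
move=> f s i a; have oU := @vb_dom_open _ _ _ _ E i.
apply: smooth_on_eq oU _ (smooth_onM oU
  (smooth_on_sub (@subsetT _ _) (smooth_funP f)) (section_smooth s i a)).
by move=> x _; rewrite linearZ mxE.
Qed.

Lemma smooth_cst_subproof (c : R) : `[< smooth_on setT (cst c : M -> R) >].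
Proof. exact/asboolP/smooth_on_cst. Qed.

Definition sectionZ (c : R) (s : section) : section :=
  section_mul (SmoothFun (smooth_cst_subproof c)) s.

Definition sectionN := sectionZ (-1).

Lemma sectionDA : associative sectionD.
Proof. by move=> u v w; apply: sectionE => x /=; rewrite addrA. Qed.
Lemma sectionDC : commutative sectionD.
Proof. by move=> u v; apply: sectionE => x /=; rewrite addrC. Qed.
Lemma section0D : left_id section0 sectionD.
Proof. by move=> u; apply: sectionE => x /=; rewrite add0r. Qed.
Lemma sectionND : left_inverse section0 sectionN sectionD.
Proof. by move=> u; apply: sectionE => x /=; rewrite scaleN1r addNr. Qed.
HB.instance Definition _ :=
  GRing.isZmodule.Build section sectionDA sectionDC section0D sectionND.

Lemma sectionZA a b u : sectionZ a (sectionZ b u) = sectionZ (a * b) u.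
Proof. by apply: sectionE => x /=; rewrite scalerA. Qed.
Lemma section1Z : left_id 1 sectionZ.
Proof. by move=> u; apply: sectionE => x /=; rewrite scale1r. Qed.
Lemma sectionZDr : right_distributive sectionZ +%R.
Proof. by move=> a u v; apply: sectionE => x /=; exact: scalerDr. Qed.
Lemma sectionZDl u : {morph sectionZ^~ u : a b / a + b}.
Proof. by move=> a b; apply: sectionE => x /=; exact: scalerDl. Qed.
HB.instance Definition _ := GRing.Zmodule_isLmodule.Build R section
  sectionZA section1Z sectionZDr sectionZDl.

Program Definition bundle_map_apply (P : bundle_map) (s : section) : section :=
  @Section (fun x => P x (s x)) _.
Next Obligation.
move=> P s j b; apply: (smooth_on_bigcup
  (U := fun i => @vb_dom _ _ _ _ E i `&` vb_dom j)) => [x Ux|i].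
  by have [i Uix] := vb_cover E x; exists i.
have oU : open (@vb_dom _ _ _ _ E i `&` vb_dom j).
  by apply: openI; exact: vb_dom_open.
have sF a : smooth_on (vb_dom i `&` vb_dom j) (fun x =>
    vb_triv i x (s x) 0 a * vb_triv j x (P x (frame i a x)) 0 b).
  apply: smooth_onM => //; last exact: bundle_map_smooth.
  by apply: smooth_on_sub (section_smooth s i a) => x [].
apply: smooth_on_eq oU _ (smooth_on_sum oU sF) => x [Ux _].
rewrite [X in P x X](frame_decomp _ Ux) !linear_sum summxE.
by apply: eq_bigr => a _; rewrite !linearZ mxE.
Qed.

Program Definition anchor_apply (rho : anchor) (s : section)
  (f : smooth_fun M) : smooth_fun M := @SmoothFun _ _ M (fun x => rho x (s x) f) _.
Next Obligation.
move=> rho s f; apply/asboolP.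
apply: (smooth_on_bigcup (U := @vb_dom _ _ _ _ E)) => [x _|i].
  exact: vb_cover.
have oU := @vb_dom_open _ _ _ _ E i.
have sF a : smooth_on (vb_dom i) (fun x =>
    vb_triv i x (s x) 0 a * rho x (frame i a x) f).
  by apply: smooth_onM => //; [exact: section_smooth|exact: anchor_smooth].
apply: smooth_on_eq oU _ (smooth_on_sum oU sF) => x Ux.
rewrite [X in rho x X](frame_decomp _ Ux) linear_sum /=.
elim/big_rec2: _ => [//|a u y _ ->].
by rewrite linearZ.
Qed.

Program Definition two_form_apply (om : two_form) (s t : section) :
  smooth_fun M := @SmoothFun _ _ M (fun x => om x (s x) (t x)) _.
Next Obligation.
move=> om s t; apply/asboolP.
apply: (smooth_on_bigcup (U := @vb_dom _ _ _ _ E)) => [x _|i].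
  exact: vb_cover.
have oU := @vb_dom_open _ _ _ _ E i.
have sF a : smooth_on (vb_dom i) (fun x => \sum_b vb_triv i x (s x) 0 a *
    (vb_triv i x (t x) 0 b * om x (frame i a x) (frame i b x))).
  apply: smooth_on_sum => // b; apply: smooth_onM => //.
    exact: section_smooth.
  by apply: smooth_onM => //; [exact: section_smooth|exact: two_form_smooth].
apply: smooth_on_eq oU _ (smooth_on_sum oU sF) => x Ux.
rewrite [in RHS](frame_decomp (s x) Ux) linear_sumlz /=; apply: eq_bigr => a _.
rewrite linearZl_LR /= [in RHS](frame_decomp (t x) Ux) linear_sumr mulr_sumr.
by apply: eq_bigr => b _; rewrite [om x _ (_ *: _)]linearZr_LR.
Qed.

End Bundles.

Notation "f *s: s" := (section_mul f s) (at level 40, left associativity).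

Section Algebroids.
Context {R : realType} {n r : nat} {M : manifold R n} {E : vector_bundle M r}.
Local Notation GammaE := (section E).
Local Notation CM := (smooth_fun M).
Implicit Types (br star : GammaE -> GammaE -> GammaE).
Implicit Types (rho : anchor E) (om : two_form E) (P : bundle_map E).

Definition bilinear_op (op : GammaE -> GammaE -> GammaE) : Prop :=
  (forall e, linear (op^~ e)) /\ (forall e, linear (op e)).

Definition lie_algebroid br rho : Prop :=
  [/\ bilinear_op br,
      forall e, br e e = 0,
      forall e1 e2 e3,
        br e1 (br e2 e3) + br e2 (br e3 e1) + br e3 (br e1 e2) = 0
    & forall e1 e2 (f : CM),
        br e1 (f *s: e2) = f *s: br e1 e2 + anchor_apply rho e1 f *s: e2].

Definition closed_form br rho om : Prop :=
  let rho' := anchor_apply rho in let om' := two_form_apply om in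
  forall x y z,
    rho' x (om' y z) - rho' y (om' x z) + rho' z (om' x y)
    - om' (br x y) z + om' (br x z) y - om' (br y z) x = 0.

Definition symplectic_lie_algebroid br rho om : Prop :=
  [/\ lie_algebroid br rho, nondegenerate_form om & closed_form br rho om].

Definition involutive_map P : Prop := forall x (v : E x), P x (P x v) = v.

Definition para_complex_structure br P : Prop :=
  let P' := bundle_map_apply P in
  involutive_map P /\
  forall e1 e2,
    P' (br e1 e2) = br (P' e1) e2 + br e1 (P' e2) - P' (br (P' e1) (P' e2)).

Definition para_kahler_lie_algebroid br rho om P : Prop :=
  let P' := bundle_map_apply P in let om' := two_form_apply om in
  [/\ symplectic_lie_algebroid br rho om,
      para_complex_structure br P
    & forall e1 e2, om' (P' e1) e2 + om' e1 (P' e2) = 0].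

Definition commutator star : GammaE -> GammaE -> GammaE :=
  fun e1 e2 => star e1 e2 - star e2 e1.

Definition associator star (e1 e2 e3 : GammaE) : GammaE :=
  star e1 (star e2 e3) - star (star e1 e2) e3.

(* D f is the section with (D f, e)_- = rho(e)(f) for all e; it exists and is
   unique when om is nondegenerate, and is 0 by convention if there is none. *)
Definition dual_differential rho om (f : CM) : GammaE :=
  xget 0 [set d : GammaE |
    forall e, two_form_apply om d e = anchor_apply rho e f].

Definition T_form star om (e1 e2 e3 : GammaE) : CM :=
  let om' := two_form_apply om in
  om' (star e1 e2) e3 + om' e1 (star e2 e3)
  - om' (star e2 e1) e3 - om' e2 (star e1 e3).

Definition pre_symplectic_algebroid star rho om : Prop :=
  let rho' := anchor_apply rho in let om' := two_form_apply om in
  let D := dual_differential rho om in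
  [/\ nondegenerate_form om,
      bilinear_op star,
      forall e1 e2 e3,
        associator star e1 e2 e3 - associator star e2 e1 e3
        = 6%:R^-1 *: D (T_form star om e1 e2 e3)
    & forall e1 e2 e3,
        rho' e1 (om' e2 e3)
        = om' (star e1 e2 - 2%:R^-1 *: D (om' e1 e2)) e3
          + om' e2 (commutator star e1 e3)].

Definition para_complex_pre_symplectic_algebroid star rho om P : Prop :=
  let P' := bundle_map_apply P in let om' := two_form_apply om in
  [/\ pre_symplectic_algebroid star rho om,
      involutive_map P,
      forall e1 e2, om' (P' e1) (P' e2) = - om' e1 e2
    & forall e1 e2,
        P' (star e1 e2)
        = star (P' e1) e2 + star e1 (P' e2) - P' (star (P' e1) (P' e2))].
End Algebroids.

(* Main.v *)
Require Import Defs.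
From HB Require Import structures.
From mathcomp Require Import all_boot all_order all_algebra.
From mathcomp Require Import all_classical all_reals all_analysis.
From mathcomp Require Import ring lra.
Set Implicit Arguments.
Unset Strict Implicit.
Unset Printing Implicit Defensive.
Import Order.TTheory GRing.Theory Num.Theory.
Import numFieldNormedType.Exports.
Local Open Scope classical_set_scope.
Local Open Scope ring_scope.

(** Write w for the form, D f for the section with w (D f, e) = rho(e) f, and
let a product and a bracket be related by the Koszul-type formula
<<
  w (x * y, z) = rho(x) w(y, z) + 1/2 rho(z) w(x, y) - w (y, [x, z]).
>>
Axiom (ii) of a pre-symplectic algebroid says exactly that this formula holds
for the commutator bracket ([metric_koszul]), so both halves of the theorem
are about one formula.

From the product to the bracket: antisymmetrizing the formula in x and y is
the closedness of w; replacing z by f z in it gives the Leibniz rule; and the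
cyclic sum of the left-hand side of axiom (i), which is the Jacobiator, is 1/6
of D of the cyclic sum of T, which vanishes by skew-symmetry of w.

From the bracket to the product: the right-hand side is C^oo(M)-linear in z,
hence is w (d, z) for a unique section d, which defines the product; by
closedness its commutator is the given bracket ([koszul_commutator]). One has
x * y = L_x y + 1/2 D w(x, y), where L_x is the Lie derivative on E^*,
transported to E by w. Since rho preserves brackets ([anchor_bracket]), L is a
flat representation and L_x (D f) = D (rho(x) f); so the left-hand side
of axiom (i) is D of a function, and expanding both sides identifies this function with T / 6
([koszul_associator]). Compatibility with P is a comparison of Koszul formulas,
P being skew for w.

Two facts about sections are used throughout: a section s is determined by the
functions w (s, e), and a C^oo(M)-linear map from sections to functions is of
the form w (d, _) ([tensorial_representable]). Both need global sections with
prescribed value at a point, hence smooth functions with small support on M;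
these are built from the functions t^-m exp(-1/t), a family closed under
differentiation up to linear combinations. *)

(** * Flat functions *)

Section FlatFunction.
Context {R : realType}.
Implicit Types (t u : R) (m : nat).

(** The whole family is needed because it is stable under differentiation,
unlike the function exp(-1/t) alone. *)
Definition flat m t : R := if 0 < t then t^-1 ^+ m * expR (- t^-1) else 0.

Lemma flat_gt0 m t : 0 < t -> 0 < flat m t.
Proof. by move=> t0; rewrite /flat t0 mulr_gt0 ?expR_gt0// exprn_gt0 ?invr_gt0. Qed.

Lemma flat_le0 m t : t <= 0 -> flat m t = 0.
Proof. by move=> t0; rewrite /flat ltNge t0. Qed.

Lemma flatS m t : flat m t = flat m.+1 t * t.
Proof.
rewrite /flat; case: ifPn => [t0|_]; last by rewrite mul0r.
by rewrite mulrAC exprSr mulfVK// gt_eqF.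
Qed.

(** Since exp(1/t) is the (m+1)-st power of exp(1/((m+1)t)) >= 1/((m+1)t), the
exponential beats the pole. This linear bound gives both the continuity of the
family at 0 and, through [flatS], its differentiability there. *)
Lemma flat_le m : exists C : R, forall t, `|flat m t| <= C * `|t|.
Proof.
exists (m.+1%:R ^+ m.+1) => t.
have [t0|t0] := ltP 0 t; last by rewrite flat_le0// normr0 mulr_ge0// exprn_ge0.
rewrite (gtr0_norm t0) gtr0_norm ?flat_gt0//.
rewrite flatS ler_pM2r// /flat t0 expRN.
rewrite -ler_pdivlMr ?invr_gt0 ?expR_gt0// invrK.
have -> : expR t^-1 = expR (m.+1%:R^-1 * t^-1) ^+ m.+1.
  by rewrite -expRM_natl mulrA divff ?mul1r// pnatr_eq0.
rewrite -exprMn lerXn2r ?nnegrE ?mulr_ge0 ?invr_ge0 ?expR_ge0 ?(ltW t0)//.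
by rewrite -ler_pdivrMl// (le_trans _ (expR_ge1Dx _))// lerDr.
Qed.

Lemma is_derive_flat m t :
  is_derive t (1 : R) (flat m) (flat m.+2 t - m%:R * flat m.+1 t).
Proof.
have [t0|t0|->] := ltgtP t 0.
- rewrite !flat_le0 ?ltW// mulr0 subr0.
  apply: (@near_eq_is_derive _ _ _ (cst 0)).
  near=> u; rewrite flat_le0// ltW//; near: u; exact: lt_nbhsl.
- apply: (@near_eq_is_derive _ _ _
    ((fun u => u ^+ m * expR (- u)) \o (fun u => u^-1))).
    near=> u; rewrite /flat ifT//; near: u; exact: lt_nbhsr.
  have dV : is_derive t (1 : R) (fun u => u^-1) (- t ^- 2 *: 1).
    by apply: is_deriveV; rewrite gt_eqF.
  have dE : is_derive t^-1 (1 : R) (fun u => expR (- u)) (- expR (- t^-1)).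
    have dN : is_derive t^-1 (1 : R) (fun u : R => - u) (- 1) by exact: is_deriveNid.
    by apply: is_derive_eq (is_derive1_comp (is_derive_expR _) dN) _; rewrite mulrN1.
  have dX : is_derive t^-1 (1 : R) (fun u => u ^+ m) (m%:R * t^-1 ^+ m.-1).
    
    have -> : (fun u : R => u ^+ m) = id ^+ m by apply/funext => u; rewrite fctE.
    apply: is_derive_eq (is_deriveX m (is_derive_id t^-1 1)) _.
    by rewrite -[_ *: _]/(_ * _) mulr1.
  have dM := is_deriveM dX dE.
  apply: is_derive_eq (is_derive1_comp dM dV) _; rewrite /flat t0.
  rewrite -![_ *: _]/(_ * _) -[(t ^+ 2)^-1]exprVn.
  set u := t^-1; set e := expR _; rewrite /=.
  case: m {dX dM} => [|m] /=; last by rewrite !exprS; ring.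
  by rewrite !expr0 !exprS expr0; ring.
(* At 0 the difference quotient of [flat m] is [flat m.+1]. *)
- rewrite !flat_le0// mulr0 subr0; apply/is_derive1_caratheodory.
  exists (flat m.+1); split.
  + by move=> z; rewrite (flat_le0 _ (lexx 0)) !subr0 -flatS.
  + have [C HC] := flat_le m.+1.
    rewrite /prop_for /continuous_at (flat_le0 _ (lexx 0)).
    apply: (@norm_cvg0 _ _ _ _).
    apply: (@squeeze_cvgr _ _ _ _ (cst 0) (fun u => C * `|u|)).
    * by near=> u; rewrite normr_ge0 HC.
    * exact: cvg_cst.
    * rewrite -[X in _ --> X](mulr0 C); apply: cvgMr.
      by rewrite -[X in _ --> X](normr0 R); apply: cvg_norm; exact: cvg_id.
  + by rewrite flat_le0.
Unshelve. all: by end_near. Qed.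
End FlatFunction.

(** * Smoothness of composites *)

Section Composition.
Context {R : realType} {n : nat}.
Implicit Types (U : set 'rV[R]_n) (g : 'rV[R]_n -> R).

Lemma is_derive1_comp_rV (h : R -> R) (dh : R) g (x : 'rV[R]_n) :
  is_derive (g x) (1 : R) h dh -> differentiable g x ->
  differentiable (h \o g) x /\ forall v, 'D_v (h \o g) x = dh * 'D_v g x.
Proof.
move=> hh dg.
have dfh : differentiable h (g x) by apply/derivable1_diffP; case: hh.
have dhg : differentiable (h \o g) x by exact: differentiable_comp.
split=> // v; rewrite !deriveE// diff_comp//=.
rewrite -[X in 'd h _ X]mulr1 -[_ * 1]/(_ *: 1) linearZ /= -deriveE//.
by rewrite -(deriveE _ dfh); case: hh => _ ->; rewrite -[_ *: _]/(_ * _) mulrC.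
Qed.

(** The induction on k goes through for all m at once: a derivative of
[flat m \o g] is a combination of other members of the family composed with g. *)
Lemma Ck_flat k U g m : open U -> Ck k U g -> Ck k U (flat m \o g).
Proof.
move=> oU; elim: k g m => [|k IH] g m.
  move=> cg x Ux; apply: continuous_comp; first exact: cg.
  apply: differentiable_continuous; apply/derivable1_diffP.
  by have [] := is_derive_flat m (g x).
move=> Cg; have [dg Dg] := Cg; split=> [x Ux|v].
  by have [] := is_derive1_comp_rV (is_derive_flat m (g x)) (dg x Ux).
have CD : Ck k U ((flat m.+2 \o g + cst (- m%:R) * (flat m.+1 \o g)) * 'D_v g).
  apply: (CkM oU _ (Dg v)); apply: (CkD oU); first exact/IH/CkS.
  by apply: (CkM oU); [exact: Ck_cst|exact/IH/CkS].
apply: Ck_eq CD => // x Ux.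
have [_ ->] := is_derive1_comp_rV (is_derive_flat m (g x)) (dg x Ux).
by rewrite -mulNr.
Qed.

Lemma Ck_inv k U g : open U -> (forall x, U x -> g x != 0) ->
  Ck k U g -> Ck k U (fun x => (g x)^-1).
Proof.
move=> oU g0; elim: k => [|k IH].
  by move=> cg x Ux; apply: continuousV; [exact: g0|exact: cg].
move=> Cg; have [dg Dg] := Cg.
have dV x : U x -> is_derive (g x) (1 : R) (fun u => u^-1) (- g x ^- 2 *: 1).
  by move=> Ux; apply: is_deriveV; exact: g0.
split=> [x Ux|v].
  by have [] := is_derive1_comp_rV (dV x Ux) (dg x Ux).
have CV := IH (CkS Cg).
have CD : Ck k U (cst (-1) * ((fun x => (g x)^-1) * (fun x => (g x)^-1)) * 'D_v g).
  by apply: (CkM oU _ (Dg v)); apply: (CkM oU); [exact: Ck_cst|exact: CkM].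
apply: Ck_eq CD => // x Ux.
have [_ ->] := is_derive1_comp_rV (dV x Ux) (dg x Ux).
congr (_ * _); rewrite -[LHS]/(-1 * (_ * _)) -[RHS]/(_ * 1).
by rewrite mulr1 mulN1r expr2 invfM.
Qed.
End Composition.

(** * Bump functions *)

Section SmoothOn.
Context {R : realType} {n : nat} {M : manifold R n}.
Implicit Types (O U : set M) (f : M -> R).

Lemma smooth_on_flat O f m : open O -> smooth_on O f ->
  smooth_on O (fun x => flat m (f x)).
Proof.
move=> oO sf i k; have oP := open_chart_preimage (i := i) oO.
exact: (Ck_flat m oP (sf i k)).
Qed.

Lemma smooth_onV O f : open O -> (forall x, O x -> f x != 0) -> smooth_on O f ->
  smooth_on O (fun x => (f x)^-1).
Proof.
move=> oO f0 sf i k; have oP := open_chart_preimage (i := i) oO.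
by apply: (Ck_inv oP _ (sf i k)) => y [_ Oy]; exact: f0.
Qed.

Lemma smooth_on_prod O (I : Type) (s : seq I) (F : I -> M -> R) : open O ->
  (forall a, smooth_on O (F a)) -> smooth_on O (fun x => \prod_(a <- s) F a x).
Proof.
move=> oO sF; elim: s => [|a s IH].
  have -> : (fun x : M => \prod_(a <- [::]) F a x) = cst 1.
    by apply/funext => x; rewrite big_nil.
  exact: smooth_on_cst.
have -> : (fun x => \prod_(b <- a :: s) F b x) = F a * (fun x => \prod_(b <- s) F b x).
  by apply/funext => x; rewrite big_cons.
exact: smooth_onM.
Qed.

Lemma smooth_on_chart (i : mf_idx M) (a : 'I_n) :
  smooth_on (chart_dom (mf_chart i)) (fun x => mf_chart i x 0 a).
Proof. by move=> j; exact: mf_smooth. Qed.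

Lemma exists_box (y : 'rV[R]_n) (V : set 'rV[R]_n) : nbhs y V ->
  exists2 e : R, 0 < e &
    [set z : 'rV[R]_n | forall a, `[y 0 a - e, y 0 a + e]%classic (z 0 a)] `<=` V.
Proof.
move=> /nbhs_ballP[e /= e0 eV]; exists (e / 2); first by rewrite divr_gt0.
move=> z /= yz; apply: eV; split=> // i a; rewrite ord1.
have := yz a; rewrite /= in_itv/= => /andP[z1 z2].
by rewrite /ball/= ltr_norml; apply/andP; split; lra.
Qed.

(** A product of flat functions of the coordinates, supported in a box K inside
a chart. The set W is the complement of the image of K; it is open because K is
compact and M is Hausdorff, and this is what makes extension by zero smooth. *)
Lemma exists_bump U (x0 : M) : open U -> U x0 ->
  exists (beta : smooth_fun M) (W : set M),
    [/\ open W, forall x, U x \/ W x, forall x, W x -> beta x = 0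
      & beta x0 != 0].
Proof.
move=> oU Ux0; have [i x0i] := mf_cover x0.
pose phi := mf_chart i; pose y0 := phi x0.
have /exists_box[e e0 KV] : nbhs y0
    [set y | chart_cod phi y /\ U (chart_inv phi y)].
  apply: open_nbhs_nbhs; split; first exact: open_chart_preimage.
  by split; [exact: chart_map_cod|rewrite chart_mapK].
set K := [set z | _] in KV.
have cK : compact K.
  apply: (@rV_compact _ _ (fun a => `[y0 0 a - e, y0 0 a + e]%classic)) => a.
  exact: segment_compact.
pose W := ~` (chart_inv phi @` K).
have oW : open W.
  apply: closed_openC; apply: compact_closed; first exact: mf_hausdorff.
  apply: continuous_compact => //; apply: continuous_in_subspaceT => y /set_mem Ky.
  by apply: chart_inv_continuous; apply/mem_set; have [] := KV _ Ky.
pose B x := \prod_(a < n) flat 0 (e ^+ 2 - (phi x 0 a - y0 0 a) ^+ 2).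
pose b x := if `[< chart_dom phi x >] then B x else 0.
have bW x : W x -> b x = 0.
  rewrite /b; case: asboolP => // dx Wx.
  have [a Ka] : exists a, ~ `[y0 0 a - e, y0 0 a + e]%classic (phi x 0 a).
    apply: contrapT => /forallNP nK; apply: Wx; exists (phi x).
      by move=> a; apply: contrapT; exact: nK.
    by rewrite chart_mapK.
  rewrite /B (bigD1 a)//= flat_le0 ?mul0r// subr_le0.
  rewrite -[leRHS]real_normK ?num_real// lerXn2r ?nnegrE ?(ltW e0)//.
  rewrite leNgt; apply/negP => ae; apply: Ka; rewrite /= in_itv/=.
  by move: ae; rewrite ltr_norml => /andP[? ?]; apply/andP; split; lra.
have sb : smooth_on setT b.
  apply: (smooth_on_bigcup (U := fun c : bool => if c then chart_dom phi else W)).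
    move=> x _; have [dx|ndx] := pselect (chart_dom phi x); first by exists true.
    exists false => -[y Ky yx]; apply: ndx; rewrite -yx.
    by apply: chart_inv_dom; have [] := KV _ Ky.
  case; last first.
    apply: (@smooth_on_eq _ _ _ _ (cst 0)) => //; first by move=> x /bW ->.
    exact: smooth_on_cst.
  have oD := chart_dom_open phi.
  apply: (@smooth_on_eq _ _ _ _ B) => //.
    by move=> x dx; rewrite /b asboolT.
  apply: smooth_on_prod => // a; apply: smooth_on_flat => //.
  have sc : smooth_on (chart_dom phi) (fun x => phi x 0 a - y0 0 a).
    exact: (smooth_onD oD (smooth_on_chart i a) (smooth_on_cst _ (- y0 0 a))).
  have := smooth_onM oD (smooth_on_cst _ (-1)) (smooth_onM oD sc sc).
  move=> /(smooth_onD oD (smooth_on_cst _ (e ^+ 2))); apply: smooth_on_eq => //.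
  by move=> x _; rewrite !fctE mulN1r expr2.
exists (SmoothFun (asboolT sb)), W; split=> //.
  move=> x; have [Ux|nUx] := pselect (U x); [by left|right=> -[y Ky yx]].
  by apply: nUx; rewrite -yx; have [] := KV _ Ky.
rewrite /= /b asboolT// /B prodf_seq_neq0; apply/allP => a _ /=.
by rewrite gt_eqF// flat_gt0// subrr expr0n subr0 exprn_gt0.
Qed.
End SmoothOn.

(** * Smoothness of matrix inverses, and cutting off functions *)

Section Local.
Context {R : realType} {n : nat} {M : manifold R n}.
Implicit Types (O U W : set M) (f : M -> R).

Lemma smooth_fun_continuous (f : smooth_fun M) : continuous f.
Proof.
move=> x; have [i di] := mf_cover x; pose phi := mf_chart i.
have cf : {for phi x, continuous (f \o chart_inv phi)}.
  by apply: (smooth_funP f i 0%N); split=> //; exact: chart_map_cod.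
have cp : {for x, continuous phi}.
  exact: (chart_map_continuous (c := phi) (mem_set di)).
have := continuous_comp cp cf.
rewrite /prop_for /continuous_at /= chart_mapK//; apply: cvg_trans; apply: near_eq_cvg.
near=> y; rewrite /= chart_mapK//; near: y.
by apply: open_nbhs_nbhs; split=> //; exact: chart_dom_open.
Unshelve. all: by end_near. Qed.

Lemma open_smooth_neq0 (f : smooth_fun M) : open [set x | f x != 0].
Proof.
apply: (@open_comp _ _ f [set y | y != 0]); last exact: open_neq.
by move=> x _; exact: smooth_fun_continuous.
Qed.

Lemma smooth_on_bigsum O (I : Type) (s : seq I) (F : I -> M -> R) : open O ->
  (forall a, smooth_on O (F a)) -> smooth_on O (fun x => \sum_(a <- s) F a x).
Proof.
move=> oO sF; elim: s => [|a s IH].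
  have -> : (fun x : M => \sum_(a <- [::]) F a x) = cst 0.
    by apply/funext => x; rewrite big_nil.
  exact: smooth_on_cst.
have -> : (fun x => \sum_(b <- a :: s) F b x) = F a + (fun x => \sum_(b <- s) F b x).
  by apply/funext => x; rewrite big_cons.
exact: smooth_onD.
Qed.

Lemma smooth_on_det O k (A : M -> 'M[R]_k) : open O ->
  (forall i j, smooth_on O (fun x => A x i j)) -> smooth_on O (fun x => \det (A x)).
Proof.
move=> oO sA; apply: smooth_on_bigsum => // s.
by apply: smooth_onZ => //; exact: smooth_on_prod.
Qed.

Lemma smooth_on_invmx O k (A : M -> 'M[R]_k) : open O ->
  (forall x, O x -> A x \in unitmx) ->
  (forall i j, smooth_on O (fun x => A x i j)) ->
  forall i j, smooth_on O (fun x => invmx (A x) i j).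
Proof.
move=> oO uA sA i j.
have sd : smooth_on O (fun x => (\det (A x))^-1).
  apply: smooth_onV => //; last exact: smooth_on_det.
  by move=> x /uA; rewrite unitmxE unitfE.
have sc : smooth_on O (fun x => cofactor (A x) j i).
  apply: smooth_onZ => //; apply: smooth_on_det => // a b.
  have -> : (fun x => row' j (col' i (A x)) a b) = fun x => A x (lift j a) (lift i b).
    by apply/funext => x; rewrite !mxE.
  exact: sA.
apply: smooth_on_eq oO _ (smooth_onM oO sd sc) => x Ox.
by rewrite /invmx uA// !mxE.
Qed.

Lemma smooth_cutoff U W (beta : smooth_fun M) f :
  open W -> (forall x, U x \/ W x) -> (forall x, W x -> beta x = 0) ->
  open U -> smooth_on U f -> smooth_on setT (fun x => beta x * f x).
Proof.
move=> oW UW bW oU sf.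
apply: (smooth_on_bigcup (U := fun c : bool => if c then U else W)).
  by move=> x _; have [Ux|Wx] := UW x; [exists true|exists false].
case; last first.
  apply: (@smooth_on_eq _ _ _ _ (cst 0)) => //; last exact: smooth_on_cst.
  by move=> x /bW ->; rewrite mul0r.
by apply: smooth_onM => //; apply: smooth_on_sub (smooth_funP beta).
Qed.

Lemma smooth_fun_mulE (f g : smooth_fun M) x : (f * g) x = f x * g x.
Proof. by []. Qed.
Lemma smooth_fun_addE (f g : smooth_fun M) x : (f + g) x = f x + g x.
Proof. by []. Qed.
Lemma smooth_fun_oppE (f : smooth_fun M) x : (- f) x = - f x.
Proof. by []. Qed.
Lemma smooth_fun_scaleE (c : R) (f : smooth_fun M) x : (c *: f) x = c * f x.
Proof. by []. Qed.
Lemma smooth_fun_0E x : (0 : smooth_fun M) x = 0.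
Proof. by []. Qed.

Definition smooth_fun_valE := (smooth_fun_mulE, smooth_fun_addE,
  smooth_fun_oppE, smooth_fun_scaleE, smooth_fun_0E).
End Local.

(** * Global sections with prescribed values *)

Section Sections.
Context {R : realType} {n r : nat} {M : manifold R n} (E : vector_bundle M r).

Lemma section_mulE (f : smooth_fun M) (s : section E) x : (f *s: s) x = f x *: s x.
Proof. by []. Qed.

Lemma section_sumE (I : Type) (l : seq I) (s : I -> section E) x :
  (\sum_(a <- l) s a) x = \sum_(a <- l) s a x.
Proof. exact: (big_morph (fun s : section E => s x) (id1 := 0) (op1 := +%R)). Qed.

Lemma smooth_fun_sumE (I : Type) (l : seq I) (f : I -> smooth_fun M) x :
  (\sum_(a <- l) f a) x = \sum_(a <- l) f a x.
Proof. exact: (big_morph (fun f : smooth_fun M => f x) (id1 := 0) (op1 := +%R)). Qed.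

(** A local frame and local functions become global after multiplication by a
bump function, whose value at the chosen point can then be divided out. *)
Lemma exists_cutoff_frame (i : vb_idx E) x0 : vb_dom i x0 ->
  exists (beta : smooth_fun M) (sig : 'I_r -> section E),
    [/\ forall x, vb_dom i x \/ beta x = 0,
        beta x0 != 0,
        forall a x, sig a x = beta x *: frame i a x
      & forall f, smooth_on (vb_dom i) f ->
          exists g : smooth_fun M, forall x, g x = beta x * f x].
Proof.
move=> dx0; have oU := @vb_dom_open _ _ _ _ E i.
have [beta [W [oW UW bW b0]]] := exists_bump oU dx0.
have ssig a : forall j b,
    smooth_on (vb_dom j) (fun x => vb_triv j x (beta x *: frame i a x) 0 b).
  move=> j b.
  apply: (smooth_on_bigcup (U := fun c : bool =>
    vb_dom j `&` (if c then vb_dom i else W))).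
    by move=> x jx; have [Ux|Wx] := UW x; [exists true|exists false].
  have oj := @vb_dom_open _ _ _ _ E j.
  case; last first.
    apply: (@smooth_on_eq _ _ _ _ (cst 0)); [exact: openI| |exact: smooth_on_cst].
    by move=> x [_ /bW ->]; rewrite scale0r linear0 mxE.
  have oI : open (vb_dom j `&` vb_dom i) by exact: openI.
  have sf := vb_smooth i j (delta_mx 0 a) b; rewrite setIC in sf.
  have sb : smooth_on (vb_dom j `&` vb_dom i) beta.
    exact: smooth_on_sub (smooth_funP beta).
  apply: smooth_on_eq oI _ (smooth_onM oI sb sf) => x _.
  by rewrite linearZ mxE.
exists beta, (fun a => Section (ssig a)); split=> //.
  by move=> x; have [|/bW] := UW x; [left|right].
move=> f sf; by exists (SmoothFun (asboolT (smooth_cutoff oW UW bW oU sf))).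
Qed.

Lemma section_through x (v : E x) : exists s : section E, s x = v.
Proof.
have [i dx] := vb_cover E x.
have [beta [sig [_ b0 sigE _]]] := exists_cutoff_frame dx.
exists (\sum_a ((vb_triv i x v 0 a / beta x) *: sig a)).
rewrite section_sumE [RHS](frame_decomp v dx); apply: eq_bigr => a _.
by rewrite /= sigE scalerA divfK.
Qed.

Section Tensorial.
Variable phi : section E -> smooth_fun M.
Hypothesis phiD : forall s t, phi (s + t) = phi s + phi t.
Hypothesis phiM : forall f s, phi (f *s: s) = f * phi s.

Lemma tensorial_sum (I : Type) (l : seq I) (s : I -> section E) :
  phi (\sum_(a <- l) s a) = \sum_(a <- l) phi (s a).
Proof.
apply: (big_morph phi) => //.
by apply: (addrI (phi 0)); rewrite -phiD !addr0.
Qed.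

(** If e vanishes at x then beta^2 e is a combination of the global sections
beta e_a with coefficients beta e^a that vanish at x; the bump function enters
once to globalize the frame and once to globalize the coordinates. *)
Lemma tensorial_local (s t : section E) x : s x = t x -> phi s x = phi t x.
Proof.
have loc0 (e : section E) : e x = 0 -> phi e x = 0.
  move=> ex0; have [i dx] := vb_cover E x.
  have [beta [sig [bU b0 sigE cut]]] := exists_cutoff_frame dx.
  have /choice[g gE] : forall a, exists g : smooth_fun M,
      forall y, g y = beta y * vb_triv i y (e y) 0 a.
    by move=> a; apply: cut; exact: section_smooth.
  have /(congr1 (fun u => phi u x)) :
      (beta * beta) *s: e = \sum_a g a *s: sig a.
    apply: sectionE => y; rewrite section_sumE section_mulE smooth_fun_mulE.
    have [dy|by0] := bU y; last first.
      rewrite by0 mulr0 scale0r big1// => a _.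
      by rewrite /= gE by0 mul0r scale0r.
    rewrite [in LHS](frame_decomp (e y) dy) scaler_sumr; apply: eq_bigr => a _.
    by rewrite section_mulE gE sigE !scalerA mulrAC.
  rewrite phiM !smooth_fun_mulE tensorial_sum smooth_fun_sumE big1 => [|a _]; last first.
    by rewrite phiM smooth_fun_mulE gE ex0 linear0 mxE mulr0 mul0r.
  by move/eqP; rewrite !mulf_eq0 (negbTE b0) /= => /eqP.
move=> st; have : phi (s + (-1) *: t) x = 0.
  by apply: loc0; rewrite /= st scaleN1r subrr.
rewrite phiD.
have -> : phi ((-1) *: t) = (SmoothFun (smooth_cst_subproof (-1))) * phi t by exact: phiM.
by rewrite /= mulN1r => /eqP; rewrite subr_eq0 => /eqP.
Qed.
End Tensorial.
End Sections.

(** * Representation of tensorial functionals by a nondegenerate form *)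

Section Riesz.
Context {R : realType} {n r : nat} {M : manifold R n} (E : vector_bundle M r).
Variable om : two_form E.

Definition gram (i : vb_idx E) x : 'M[R]_r :=
  \matrix_(a, b) om x (frame i a x) (frame i b x).

Lemma two_form_gram i x (u v : E x) : vb_dom i x ->
  om x u v = \sum_b (vb_triv i x u *m gram i x) 0 b * vb_triv i x v 0 b.
Proof.
move=> dx; rewrite [in LHS](frame_decomp v dx) linear_sumr; apply: eq_bigr => b _.
rewrite [om x _ (_ *: _)]linearZr_LR /= mulrC; congr (_ * _).
rewrite [in LHS](frame_decomp u dx) linear_sumlz mxE; apply: eq_bigr => a _.
by rewrite linearZl_LR mxE.
Qed.

Hypothesis nd : nondegenerate_form om.

Lemma gram_unit i x : vb_dom i x -> gram i x \in unitmx.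
Proof.
move=> dx; rewrite -row_free_unit; apply: inj_row_free => w wG.
rewrite -(vb_invK dx w) (_ : vb_inv i x w = 0) ?linear0//.
apply: nd => v; rewrite (two_form_gram _ _ dx) (vb_invK dx) wG.
by rewrite big1// => b _; rewrite mxE mul0r.
Qed.

Lemma section_nondegenerate (s t : section E) :
  (forall e, two_form_apply om s e = two_form_apply om t e) -> s = t.
Proof.
move=> st; apply: sectionE => x; apply/eqP; rewrite -subr_eq0; apply/eqP/nd => v.
have [e <-] := section_through v.
by rewrite linearBl /= -[om x (s x) _]/(two_form_apply om s e x) st subrr.
Qed.

Section Representation.
Variable phi : section E -> smooth_fun M.
Hypothesis phiD : forall s t, phi (s + t) = phi s + phi t.
Hypothesis phiM : forall f s, phi (f *s: s) = f * phi s.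

(* [Phi] is the linear form on the fibres induced by [phi]; by locality it does
   not depend on the extension [ext v] of the vector [v]. *)
Let ext x (v : E x) : section E := projT1 (cid (section_through v)).
Let extE x (v : E x) : ext v x = v.
Proof. exact: projT2 (cid (section_through v)). Qed.
Let Phi x (v : E x) : R := phi (ext v) x.

Let PhiE e x : phi e x = Phi (e x).
Proof. by apply: (tensorial_local phiD phiM); rewrite extE. Qed.

Let Phi_frame i x (v : E x) : vb_dom i x ->
  Phi v = \sum_b Phi (frame i b x) * vb_triv i x v 0 b.
Proof.
move=> dx.
transitivity (phi (\sum_b (vb_triv i x v 0 b *: ext (frame i b x))) x).
  rewrite PhiE section_sumE /=; congr Phi; rewrite [LHS](frame_decomp v dx).
  by apply: eq_bigr => b _; rewrite extE.
rewrite (tensorial_sum phiD) smooth_fun_sumE; apply: eq_bigr => b _.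
by rewrite [phi _](phiM (SmoothFun _)) mulrC.
Qed.

Let smooth_Phi i b : smooth_on (vb_dom i) (fun x => Phi (frame i b x)).
Proof.
apply: (smooth_on_bigcup (U := fun p : {U : set M | open U /\
   smooth_on U (fun x => Phi (frame i b x))} => sval p)); last by case=> U [].
move=> x0 dx0; have [beta [sig [_ b0 sigE _]]] := exists_cutoff_frame dx0.
pose U := [set x | beta x != 0].
have oU : open U by exact: open_smooth_neq0.
suff sU : smooth_on U (fun x => Phi (frame i b x)).
  by exists (exist _ U (conj oU sU)).
(* On U the function is the quotient of [phi (sig b)] by [beta]. *)
have sV : smooth_on U (fun x => (beta x)^-1).
  by apply: smooth_onV => //; apply: smooth_on_sub (smooth_funP beta).
have sS : smooth_on U (phi (sig b)).
  by apply: smooth_on_sub (smooth_funP _).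
apply: smooth_on_eq oU _ (smooth_onM oU sV sS) => x Ux.
rewrite -[LHS]/((beta x)^-1 * phi (sig b) x).
rewrite -[RHS]mul1r -(mulVf Ux) -mulrA; congr (_ * _).
rewrite -[RHS]smooth_fun_mulE -phiM; apply: (tensorial_local phiD phiM).
by rewrite sigE section_mulE extE.
Qed.

(* The coordinates that a vector representing [Phi] must have in the frame [i]. *)
Let rep i x : 'rV[R]_r := \row_b Phi (frame i b x) *m invmx (gram i x).

Let rep_frame i x (u : E x) : vb_dom i x ->
  (forall v, om x u v = Phi v) <-> vb_triv i x u = rep i x.
Proof.
move=> dx; split=> [uP|uE v]; last first.
  rewrite (two_form_gram _ _ dx) uE mulmxKV ?gram_unit// (Phi_frame _ dx).
  by apply: eq_bigr => b _; rewrite mxE.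
apply: (canRL (mulmxK (gram_unit dx))); apply/rowP => b; rewrite [RHS]mxE -uP.
rewrite (two_form_gram _ _ dx) (bigD1 b)//= vb_invK// [delta_mx _ _ _ _]mxE !eqxx mulr1.
by rewrite big1 ?addr0// => c cb; rewrite [delta_mx _ _ _ _]mxE (negbTE cb) andbF mulr0.
Qed.

(** Fibrewise this is the nondegeneracy of the form; the representing vectors
depend smoothly on the point because, in a frame, their coordinates are those of
the functional times the inverse of the Gram matrix. *)
Lemma tensorial_representable : exists d, forall e, two_form_apply om d e = phi e.
Proof.
have ex x : exists u : E x, forall v, om x u v = Phi v.
  have [i dx] := vb_cover E x.
  by exists (vb_inv i x (rep i x)); apply/(rep_frame _ dx); rewrite vb_invK.
pose d x := projT1 (cid (ex x)).
have dP x v : om x (d x) v = Phi v by exact: (projT2 (cid (ex x))).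
have sd i a : smooth_on (vb_dom i) (fun x => vb_triv i x (d x) 0 a).
  have oU := @vb_dom_open _ _ _ _ E i.
  have sI b : smooth_on (vb_dom i) (fun x => invmx (gram i x) b a).
    apply: smooth_on_invmx => // [x|c e]; first exact: gram_unit.
    apply: smooth_on_eq oU _ (two_form_smooth om i c e) => x _.
    by rewrite mxE.
  have sF b := smooth_onM oU (smooth_Phi i b) (sI b).
  apply: smooth_on_eq oU _ (smooth_on_sum oU sF) => x dx.
  rewrite (rep_frame (d x) dx).1// mxE; apply: eq_bigr => b _.
  by rewrite mxE.
exists (Section sd) => e; apply: smooth_funE => x.
by rewrite PhiE; exact: dP.
Qed.
End Representation.
End Riesz.

(** * Calculus of sections, forms and anchors *)

(** For the operations on sections, whose linearity is a hypothesis and not a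
structure. *)
Section LinearOps.
Context {K : pzRingType} {V W : lmodType K} (f : V -> W) (lf : linear f).

Lemma linear_D u v : f (u + v) = f u + f v.
Proof. by rewrite -[u]scale1r lf !scale1r. Qed.
Lemma linear_0 : f 0 = 0.
Proof. by apply: (addrI (f 0)); rewrite -linear_D !addr0. Qed.
Lemma linear_Z c u : f (c *: u) = c *: f u.
Proof. by rewrite -[c *: u]addr0 lf linear_0 addr0. Qed.
Lemma linear_N u : f (- u) = - f u.
Proof. by rewrite -scaleN1r linear_Z scaleN1r. Qed.
End LinearOps.

Section Calculus.
Context {R : realType} {n r : nat} {M : manifold R n} {E : vector_bundle M r}.
Implicit Types (s t e x y z : section E) (f g : smooth_fun M) (c : R).

(** Identities between sections are checked on their coordinates, where they
become identities between real numbers. *)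
Definition coord (i : vb_idx E) p a s : R := vb_triv i p (s p) 0 a.

Lemma section_coordE s t :
  (forall i p a, vb_dom i p -> coord i p a s = coord i p a t) -> s = t.
Proof.
move=> st; apply: sectionE => p; have [i dp] := vb_cover E p.
by apply: (can_inj (vb_trivK dp)); apply/rowP => a; exact: st.
Qed.

Section Coord.
Variables (i : vb_idx E) (p : M) (a : 'I_r).
Local Notation co := (coord i p a).
Lemma coordD s t : co (s + t) = co s + co t.
Proof. by rewrite /coord [X in vb_triv _ _ X]/= linearD mxE. Qed.
Lemma coordM f s : co (f *s: s) = f p * co s.
Proof. by rewrite /coord /= linearZ mxE. Qed.
Lemma coordZ c s : co (c *: s) = c * co s.
Proof. exact: coordM. Qed.
Lemma coordN s : co (- s) = - co s.
Proof. by rewrite -[- s]scaleN1r coordZ mulN1r. Qed.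
Lemma coord0 : co 0 = 0.
Proof. by rewrite -[0](scale0r (0 : section E)) coordZ mul0r. Qed.
Definition coordE := (coordD, coordN, coordZ, coordM, coord0).
End Coord.

Section Form.
Variable om : two_form E.
Local Notation om' := (two_form_apply om).
Lemma two_form_applyC s t : om' s t = - om' t s.
Proof. by apply: smooth_funE => p; exact: two_form_skew. Qed.
Lemma two_form_applyDl s t e : om' (s + t) e = om' s e + om' t e.
Proof. by apply: smooth_funE => p; exact: linearDl. Qed.
Lemma two_form_applyMl f s e : om' (f *s: s) e = f * om' s e.
Proof. by apply: smooth_funE => p; exact: linearZl_LR. Qed.
Lemma two_form_applyZl c s e : om' (c *: s) e = c *: om' s e.
Proof. by apply: smooth_funE => p; exact: linearZl_LR. Qed.
Lemma two_form_applyNl s e : om' (- s) e = - om' s e.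
Proof. by rewrite -[- s]scaleN1r two_form_applyZl scaleN1r. Qed.
Lemma two_form_applyDr s t e : om' e (s + t) = om' e s + om' e t.
Proof. by apply: smooth_funE => p; exact: linearDr. Qed.
Lemma two_form_applyMr f s e : om' e (f *s: s) = f * om' e s.
Proof. by apply: smooth_funE => p; exact: linearZr_LR. Qed.
Lemma two_form_applyZr c s e : om' e (c *: s) = c *: om' e s.
Proof. by apply: smooth_funE => p; exact: linearZr_LR. Qed.
Lemma two_form_applyNr s e : om' e (- s) = - om' e s.
Proof. by rewrite -[- s]scaleN1r two_form_applyZr scaleN1r. Qed.
Definition two_form_applyE :=
  (two_form_applyDl, two_form_applyNl, two_form_applyZl, two_form_applyMl,
   two_form_applyDr, two_form_applyNr, two_form_applyZr, two_form_applyMr).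
End Form.

Section Anchor.
Variable rho : anchor E.
Local Notation rho' := (anchor_apply rho).
Lemma anchor_applyZD e c f g : rho' e (c *: f + g) = c *: rho' e f + rho' e g.
Proof. by apply: smooth_funE => p; exact: tangent_linear. Qed.
Lemma anchor_applyD e f g : rho' e (f + g) = rho' e f + rho' e g.
Proof. exact: linear_D (anchor_applyZD e) f g. Qed.
Lemma anchor_applyN e f : rho' e (- f) = - rho' e f.
Proof. exact: linear_N (anchor_applyZD e) f. Qed.
Lemma anchor_applyZ e c f : rho' e (c *: f) = c *: rho' e f.
Proof. exact: linear_Z (anchor_applyZD e) c f. Qed.
Lemma anchor_apply0 e : rho' e 0 = 0.
Proof. exact: linear_0 (anchor_applyZD e). Qed.
Lemma anchor_applyM e f g : rho' e (f * g) = rho' e f * g + f * rho' e g.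
Proof. by apply: smooth_funE => p; exact: tangent_leibniz. Qed.
Lemma anchor_applyDl s t f : rho' (s + t) f = rho' s f + rho' t f.
Proof. by apply: smooth_funE => p; rewrite /= linearD. Qed.
Lemma anchor_applyMl g s f : rho' (g *s: s) f = g * rho' s f.
Proof. by apply: smooth_funE => p; rewrite /= linearZ. Qed.
Lemma anchor_applyZl c s f : rho' (c *: s) f = c *: rho' s f.
Proof. by apply: smooth_funE => p; rewrite /= linearZ. Qed.
Lemma anchor_applyNl s f : rho' (- s) f = - rho' s f.
Proof. by rewrite -[- s]scaleN1r anchor_applyZl scaleN1r. Qed.
Definition anchor_applyE :=
  (anchor_applyD, anchor_applyN, anchor_applyZ, anchor_apply0, anchor_applyM,
   anchor_applyDl, anchor_applyNl, anchor_applyZl, anchor_applyMl).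

(** Expanding the Jacobi identity of x, y and f e with the Leibniz rule, what
remains besides f times the Jacobi identity of x, y and e is g e, where g is the
defect of the claim. Where the fibre is nonzero, g vanishes by choice of e; where
it is zero, so is the anchor. *)
Lemma anchor_bracket br : lie_algebroid br rho -> forall x y f,
  rho' (br x y) f = rho' x (rho' y f) - rho' y (rho' x f).
Proof.
move=> [[brl brr] br0 jac leib] x y f.
have brC u v : br u v = - br v u.
  have := br0 (u + v); rewrite (linear_D (brl _)) !(linear_D (brr _)) !br0.
  by rewrite add0r addr0 => /eqP; rewrite addr_eq0 => /eqP.
set g := rho' x (rho' y f) - rho' y (rho' x f) - rho' (br x y) f.
have ge e : g *s: e = 0.
  have := jac x y (f *s: e).
  rewrite (brC (f *s: e)) (brC (f *s: e)) (linear_N (brr _)) !leib.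
  rewrite !(linear_D (brr _)) !leib => J.
  have Je := jac x y e; rewrite (brC e) (brC e) (linear_N (brr _)) in Je.
  apply: section_coordE => i p a _.
  move: J Je => /(congr1 (coord i p a)) + /(congr1 (coord i p a)).
  rewrite /g !coordE !smooth_fun_valE => J /(congr1 ( *%R (f p))) Je.
  lra.
apply: smooth_funE => p.
apply/eqP; rewrite eq_sym -subr_eq0 -[_ - _]/(g p).
have [[v v0]|nv] := pselect (exists v : E p, v != 0).
  have [e ev] := section_through v.
  have := congr1 (fun s => s p) (ge e).
  by rewrite section_mulE ev => /eqP; rewrite scaler_eq0 (negbTE v0) orbF.
have e0 e h : rho' e h p = 0.
  rewrite /= (_ : e p = 0) ?linear0//.
  by apply/eqP/negPn/negP => ?; apply: nv; exists (e p).
by rewrite /g !smooth_fun_valE !e0 !subr0.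
Qed.
End Anchor.

Section BundleMap.
Variable P : bundle_map E.
Local Notation P' := (bundle_map_apply P).
Lemma bundle_map_applyD s t : P' (s + t) = P' s + P' t.
Proof. by apply: sectionE => p; exact: linearD. Qed.
Lemma bundle_map_applyN s : P' (- s) = - P' s.
Proof. by apply: sectionE => p; exact: linearZ. Qed.
Lemma bundle_map_applyK : involutive_map P -> involutive P'.
Proof. by move=> invP s; apply: sectionE => p; exact: invP. Qed.
End BundleMap.
End Calculus.

(** * The Koszul formula *)

Section Correspondence.
Context {R : realType} {n r : nat} {M : manifold R n} {E : vector_bundle M r}.
Variables (rho : anchor E) (om : two_form E).
Local Notation om' := (two_form_apply om).
Local Notation rho' := (anchor_apply rho).
Local Notation D := (dual_differential rho om).
Implicit Types (s t e x y z : section E) (f g : smooth_fun M) (c : R).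
Implicit Types (br star : section E -> section E -> section E).

Hypothesis nd : nondegenerate_form om.

Lemma dual_differentialE f e : om' (D f) e = rho' e f.
Proof.
have phiD s t : rho' (s + t) f = rho' s f + rho' t f by rewrite anchor_applyE.
have phiM g s : rho' (g *s: s) f = g * rho' s f by rewrite anchor_applyE.
have [d dP] := tensorial_representable nd phiD phiM.
exact: (xgetPex 0 (ex_intro (fun u => forall v, om' u v = rho' v f) d dP) e).
Qed.

Definition koszul_product br star := forall x y z,
  om' (star x y) z =
  rho' x (om' y z) + 2%:R^-1 *: rho' z (om' x y) - om' y (br x z).

Lemma metric_koszul star :
  (forall x y z, rho' x (om' y z) =
     om' (star x y - 2%:R^-1 *: D (om' x y)) z + om' y (commutator star x z)) <->
  koszul_product (commutator star) star.
Proof.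
split=> H x y z; have := H x y z.
  rewrite !(two_form_applyDl, two_form_applyNl, two_form_applyZl) dual_differentialE => ->.
  by apply: smooth_funE => p; rewrite !smooth_fun_valE; lra.
rewrite !(two_form_applyDl, two_form_applyNl, two_form_applyZl) dual_differentialE => ->.
by apply: smooth_funE => p; rewrite !smooth_fun_valE; lra.
Qed.

(** * From the product to the bracket *)

Section ToKahler.
Variable star : section E -> section E -> section E.
Hypothesis bil : bilinear_op star.
Hypothesis assocS : forall x y z,
  associator star x y z - associator star y x z
  = 6%:R^-1 *: D (T_form star om x y z).
Hypothesis kos : koszul_product (commutator star) star.
Local Notation br := (commutator star).

Lemma commutator_bilinear : bilinear_op br.
Proof.
have [sl sr] := bil; split=> e c s t; rewrite /commutator;
  by rewrite sl sr scalerBr opprD addrACA.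
Qed.

(** Subtracting from the Koszul formula its copy with x and y exchanged, the two
halves of rho(z) w(x, y) add up and the result is the closedness identity. *)
Lemma commutator_closed : closed_form br rho om.
Proof.
move=> x y z /=.
have K1 := kos x y z; have K2 := kos y x z.
have := two_form_applyDl om (star x y) (- star y x) z.
rewrite two_form_applyNl K1 K2 (two_form_applyC om y x) anchor_applyN.
rewrite -[star x y - star y x]/(br x y).
rewrite (two_form_applyC om y) (two_form_applyC om x (br y z)).
rewrite (two_form_applyC om y (br x z)) => ->.
apply: smooth_funE => p; rewrite !smooth_fun_valE; lra.
Qed.

(** The left-hand side appears in the Koszul formula for x * z tested against
f y; compare with f times the formula tested against y. *)
Lemma commutator_leibniz x y f : br x (f *s: y) = f *s: br x y + rho' x f *s: y.
Proof.
apply: (section_nondegenerate nd) => z.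
rewrite (two_form_applyC om _ z) (two_form_applyC om _ z).
have K1 := kos x z (f *s: y); have K2 := kos x z y.
apply: smooth_funE => p; move: K1 K2.
move=> /(congr1 (fun h : smooth_fun M => h p)).
move=> + /(congr1 (fun h : smooth_fun M => f p * h p)).
rewrite !two_form_applyE !anchor_applyE !smooth_fun_valE; lra.
Qed.

(** The cyclic sum of the terms w(x, y * z) - w(y, x * z) of T regroups into
minus the cyclic sum of the terms w([x, y], z), so the cyclic sum of T is 0. *)
Lemma commutator_jacobi x y z :
  br x (br y z) + br y (br z x) + br z (br x y) = 0.
Proof.
have [sl sr] := bil.
have T0 : T_form star om x y z + T_form star om y z x + T_form star om z x y = 0.
  rewrite /T_form.
  rewrite !(two_form_applyC om x) !(two_form_applyC om y) !(two_form_applyC om z).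
  apply: smooth_funE => p; rewrite !smooth_fun_valE; lra.
have As : br x (br y z) + br y (br z x) + br z (br x y) =
   (associator star x y z - associator star y x z)
   + (associator star y z x - associator star z y x)
   + (associator star z x y - associator star x z y).
  rewrite /associator /commutator !(linear_D (sl _)) !(linear_D (sr _)).
  rewrite !(linear_N (sl _)) !(linear_N (sr _)).
  apply: section_coordE => i p a _; rewrite !coordE; lra.
apply: (section_nondegenerate nd) => e; rewrite As !assocS.
rewrite !two_form_applyDl !two_form_applyZl !dual_differentialE -!scalerDr.
rewrite -!anchor_applyD T0 anchor_apply0 scaler0.
by apply: smooth_funE => p /=; rewrite linear0l.
Qed.

Lemma commutator_lie_algebroid : lie_algebroid br rho.
Proof.
split; [exact: commutator_bilinear|by move=> e; exact: subrr| |].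
  exact: commutator_jacobi.
by move=> x y f; exact: commutator_leibniz.
Qed.
End ToKahler.

(** * From the bracket to the product *)

Section FromKahler.
Variable br : section E -> section E -> section E.
Hypothesis la : lie_algebroid br rho.
Hypothesis cl : closed_form br rho om.

Lemma koszul_product_exists : exists star, koszul_product br star.
Proof.
have [[brl brr] br0 jac leib] := la.
have ex x y : exists d, forall z, om' d z =
    rho' x (om' y z) + 2%:R^-1 *: rho' z (om' x y) - om' y (br x z).
  apply: (tensorial_representable nd (phi := fun z => _)) => [s t|f s].
    rewrite (linear_D (brr _)) !two_form_applyE !anchor_applyE.
    by apply: smooth_funE => p; rewrite !smooth_fun_valE; lra.
  rewrite leib !two_form_applyE !anchor_applyE.
  by apply: smooth_funE => p; rewrite !smooth_fun_valE; lra.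
by exists (fun x y => projT1 (cid (ex x y))) => x y z; exact: (projT2 (cid (ex x y)) z).
Qed.

Lemma koszul_product_unique star star' :
  koszul_product br star -> koszul_product br star' -> star = star'.
Proof.
move=> k k'; apply/funext => x; apply/funext => y.
by apply: (section_nondegenerate nd) => z; rewrite k k'.
Qed.

Variable star : section E -> section E -> section E.
Hypothesis kos : koszul_product br star.

Lemma koszul_bilinear : bilinear_op star.
Proof.
have [[brl brr] _ _ _] := la.
split=> e c s t; apply: (section_nondegenerate nd) => z.
  rewrite !two_form_applyE !kos (linear_D (brl _)) (linear_Z (brl _)).
  rewrite !two_form_applyE !anchor_applyE.
  apply: smooth_funE => p; rewrite !smooth_fun_valE. lra.
rewrite !two_form_applyE !kos !two_form_applyE !anchor_applyE.
by apply: smooth_funE => p; rewrite !smooth_fun_valE; lra.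
Qed.

Lemma koszul_commutator : commutator star = br.
Proof.
apply/funext => x; apply/funext => y; apply: (section_nondegenerate nd) => z.
rewrite /commutator !two_form_applyE !kos (two_form_applyC om y x).
rewrite (two_form_applyC om y (br _ _)) (two_form_applyC om x (br _ _)) !anchor_applyE.
have := cl x y z; move=> /(congr1 (fun h : smooth_fun M => h _)) C.
by apply: smooth_funE => p; have := C p; rewrite !smooth_fun_valE; lra.
Qed.

(** Both sides are D of a function. With A = rho(x) w(y, z) - rho(y) w(x, z) and
B = w([x, y], z), the flatness of the Lie derivative gives 1/2 D (B - A / 2) for
the left-hand side, while T = 3 (B - A / 2). *)
Lemma koszul_associator x y z :
  associator star x y z - associator star y x z
  = 6%:R^-1 *: D (T_form star om x y z).
Proof.
have [sl sr] := koszul_bilinear; have [[brl brr] br0 jac leib] := la.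
have brC u v : br u v = - br v u.
  by rewrite -koszul_commutator /commutator opprB.
have brE : star x y - star y x = br x y by rewrite -koszul_commutator.
have -> : associator star x y z - associator star y x z =
    star x (star y z) - star y (star x z) - star (br x y) z.
  rewrite /associator -brE (linear_D (sl _)) (linear_N (sl _)).
  by apply: section_coordE => i p a _; rewrite !coordE; lra.
apply: (section_nondegenerate nd) => e.
have Jac : om' z (br (br x y) e) =
    om' z (br x (br y e)) - om' z (br y (br x e)).
  have := jac x y e; rewrite (brC e x) (brC e) (linear_N (brr _)).
  move=> /eqP; rewrite subr_eq0 => /eqP <-.
  by rewrite two_form_applyDr two_form_applyNr.
(* The first and third terms of T combine to the pairing with the bracket; this
   uses closedness, through [brE]. *)
have TE : T_form star om x y z = om' (br x y) z + om' x (star y z) - om' y (star x z).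
  rewrite /T_form -brE two_form_applyDl two_form_applyNl.
  by apply: smooth_funE => p; rewrite !smooth_fun_valE; lra.
rewrite two_form_applyZl dual_differentialE TE.
rewrite !(two_form_applyDl, two_form_applyNl).
rewrite (two_form_applyC om x (star y z)) (two_form_applyC om y (star x z)) !kos.
rewrite (two_form_applyC om x (star y z)) (two_form_applyC om y (star x z)) !kos.
rewrite !(anchor_bracket la) Jac.
rewrite (two_form_applyC om z x) (two_form_applyC om z y).
rewrite (brC y x) !two_form_applyE !anchor_applyE.
rewrite (two_form_applyC om (br x y) z) !anchor_applyE.
apply: smooth_funE => p; rewrite !smooth_fun_valE; lra.
Qed.

Variable P : bundle_map E.
Local Notation P' := (bundle_map_apply P).

(** Tested against z, the terms with rho(P x) cancel and the rest is the
para-complex identity of the bracket of x and z, paired with y. *)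
Lemma koszul_para_complex : para_complex_structure br P ->
  (forall x y, om' (P' x) y + om' x (P' y) = 0) ->
  forall x y, P' (star x y) =
    star (P' x) y + star x (P' y) - P' (star (P' x) (P' y)).
Proof.
move=> [invP Pbr] Psk x y.
have PP := bundle_map_applyK invP.
have Pl u v : om' (P' u) v = - om' u (P' v).
  by apply/eqP; rewrite -addr_eq0 Psk.
apply: (section_nondegenerate nd) => z.
rewrite two_form_applyDl two_form_applyNl two_form_applyDl.
rewrite (Pl (star x y)) (Pl (star (P' x) (P' y))) !kos.
rewrite !(Pl x) !(Pl y) !PP !anchor_applyE.
have := congr1 (om' y) (Pbr x z).
rewrite !two_form_applyDr !two_form_applyNr => H.
apply: smooth_funE => p; move: H => /(congr1 (fun h : smooth_fun M => h p)).
rewrite !smooth_fun_valE; lra.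
Qed.
End FromKahler.
End Correspondence.

(** * The theorem *)

Theorem proposition5p11 (R : realType) (n r : nat) (M : manifold R n)
    (E : vector_bundle M r) (rho : anchor E) (om : two_form E)
    (P : bundle_map E) :
  (forall star : section E -> section E -> section E,
     para_complex_pre_symplectic_algebroid star rho om P ->
     para_kahler_lie_algebroid
       (fun e1 e2 => star e1 e2 - star e2 e1) rho om P)
  /\
  (forall br : section E -> section E -> section E,
     para_kahler_lie_algebroid br rho om P ->
     let is_star (star : section E -> section E -> section E) :=
       forall e1 e2 e3 : section E,
         two_form_apply om (star e1 e2) e3
         = anchor_apply rho e1 (two_form_apply om e2 e3)
           + 2%:R^-1 *: anchor_apply rho e3 (two_form_apply om e1 e2)
           - two_form_apply om e2 (br e1 e3) in
     (exists! star, is_star star) /\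
     (forall star, is_star star ->
        para_complex_pre_symplectic_algebroid star rho om P)).
Proof.
split=>
  [star [[nd bil assocS /(metric_koszul rho nd star) kos] invP Pom Pstar]|br].
  split.
  - split=> //; last exact: (commutator_closed kos).
    exact: (commutator_lie_algebroid nd bil assocS kos).
  - split=> // x y; apply: section_coordE => i p a _.
    rewrite bundle_map_applyD bundle_map_applyN Pstar (Pstar y).
    by rewrite bundle_map_applyD bundle_map_applyN !coordE; ring.
  - move=> x y; have := Pom x (bundle_map_apply P y).
    by rewrite bundle_map_applyK// => ->; rewrite addNr.
move=> [[la nd cl] [invP Pbr] Psk] is_star.
split.
  have [star kos] := koszul_product_exists nd la.
  exists star; split=> // star' kos'; exact: (koszul_product_unique nd kos kos').
move=> star kos; have brE := koszul_commutator nd cl kos.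
split=> //.
- split=> //; first exact: (koszul_bilinear nd la kos).
    exact: (koszul_associator nd la cl kos).
  by apply/(metric_koszul rho nd star); rewrite brE.
- move=> x y; apply/eqP; rewrite -addr_eq0; apply/eqP.
  by have := Psk x (bundle_map_apply P y); rewrite bundle_map_applyK// addrC.
- exact: (koszul_para_complex nd kos).
Qed.
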